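(* Let $n=4$ and let $U,W$ be $4$-dimensional $\mathbb{F}_q$-subspaces of $V=\mathbb{F}_{q^4}^2$, and assume that $\mathbb{F}_q$ is the maximum field of linearity of $L_U$. Then $L_U=L_W$ if and only if $W=\lambda U$ or $W=\lambda U^{\perp}$ for some $\lambda\in\mathbb{F}_{q^4}^*$.
   Context: $L_X=\{\langle u\rangle_{\mathbb{F}_{q^n}}:u\in X\setminus\{0\}\}\subseteq\mathrm{PG}(1,q^n)$. The maximum field of linearity of $L$ is $\mathbb{F}_{q^e}$ with $e\mid n$ largest such that $L=L_X$ for some $\mathbb{F}_{q^e}$-subspace $X$. $U^\perp=\{v\in V:\mathbf b(u,v)=0\ \forall u\in U\}$ with respect to the $\mathbb{F}_q$-bilinear form $\mathbf b((x_1,y_1),(x_2,y_2))=Tr_{q^n|q}(x_1y_2-x_2y_1)$, where $Tr_{q^n|q}(x)=x+x^q+\dots+x^{q^{n-1}}$. *)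

(* Defs.v *)
From HB Require Import structures.
From mathcomp Require Import all_boot all_order all_algebra.
Set Implicit Arguments. Unset Strict Implicit. Unset Printing Implicit Defensive.
Import Order.TTheory GRing.Theory.
Local Open Scope ring_scope.

(* Setting: L is a finite field with #|L| = q^n, i.e. L = F_{q^n}.
   V = L^2 is modelled as L * L; subsets of V are {set L * L}. *)

Section Defs.
Variable L : finFieldType.

Definition vscale (c : L) (v : L * L) : L * L := (c * v.1, c * v.2).

(* X is an F_{q^e}-subspace of V, where F_{q^e} = {c in L | c^(q^e) = c} *)
Definition Fsubspace (q e : nat) (X : {set L * L}) : Prop :=
  [/\ (0, 0) \in X,
      forall u v, u \in X -> v \in X -> (u.1 + v.1, u.2 + v.2) \in X &
      forall c u, c ^+ (q ^ e) = c -> u \in X -> vscale c u \in X].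

(* the point <u>_{F_{q^n}} of PG(1,q^n), as the 1-dim L-subspace spanned by u *)
Definition pt (u : L * L) : {set L * L} := [set vscale c u | c : L].

Definition linset (X : {set L * L}) : {set {set L * L}} :=
  [set pt u | u in X :\ (0, 0)].

Definition max_field_linearity (q n e : nat) (U : {set L * L}) : Prop :=
  [/\ (e %| n)%N,
      exists X, Fsubspace q e X /\ linset X = linset U &
      forall e', (e' %| n)%N -> (exists X, Fsubspace q e' X /\ linset X = linset U) ->
        (e' <= e)%N].

Definition trace (q n : nat) (x : L) : L := \sum_(i < n) x ^+ (q ^ i).

Definition bform (q n : nat) (u v : L * L) : L := trace q n (u.1 * v.2 - v.1 * u.2).

Definition perp (q n : nat) (U : {set L * L}) : {set L * L} :=
  [set v | [forall u in U, bform q n u v == 0]].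

Definition sscale (c : L) (U : {set L * L}) : {set L * L} := [set vscale c u | u in U].

End Defs.

(* Main.v *)
(* Choose a point [<v>] off [L_U] and a basis [w, v] of determinant 1: then [U] and [W] are
   the graphs of two F_q-linear maps [f] and [g], i.e. of q-polynomials with coefficients
   [a_0, .., a_3] and [b_0, .., b_3], and [U^perp] is the graph of the adjoint of [f].  Linear
   sets correspond to sets of eigenvalues, and a nonzero eigenspace has order 0 modulo
   the characteristic; so [L_U = L_W] forces
     sum_(x != 0) phi (f x / x) = sum_(x != 0) phi (g x / x)
   for every function [phi].  Taking for [phi m] the powers of [m - a_0] with exponents
   1, 1 + q, 1 + q^2, 1 + q + q^2 and, when [a_2 = 0], 1 + q + q^2 + q^3, one finds that
     a_0,  a_1 a_3^q,  a_2^(1+q^2),  a_1^(1+q) a_2^(q^2) + a_2 a_3^(q+q^2)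
   and, when [a_2 = 0], N(a_1) + N(a_3) agree for [f] and [g].  In both cases two quantities
   have the same sum and the same product for [f] and for [g]; up to replacing [g] by its
   adjoint they are equal, which yields N(b_1 / a_1) = 1, and Hilbert's Theorem 90 produces
   the scalar.  The degenerate case a_1 = a_3 = 0 is that of an F_{q^2}-subspace. *)

Require Import Defs.
From HB Require Import structures.
From mathcomp Require Import all_boot all_order all_algebra all_field.
From mathcomp Require Import zify ring.
Import GRing.Theory.
Local Open Scope ring_scope.

Set Implicit Arguments.
Unset Strict Implicit.
Unset Printing Implicit Defensive.

(** * Base-[q] digits modulo [q ^ 4 - 1] *)

Lemma eq_of_modn_close (m a b : nat) :
  (a < b + m)%N -> (b < a + m)%N -> a = b %[mod m] -> a = b.
Proof.
wlog le_ba : a b / (b <= a)%N => [th | lt_a _ /eqP].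
  by have [/th //|/ltnW/th h] := leqP b a => *; symmetry; apply: h.
by rewrite eqn_mod_dvd // /dvdn modn_small; lia.
Qed.

(** The left digits are bounded only through the common digit sum, at most 4. For [q >= 4] the two
    sides are too close to differ by a multiple of the modulus, and digits are then compared one by
    one modulo [q]. *)
Lemma base_digits_eq (q n0 n1 n2 n3 d0 d1 d2 d3 : nat) :
  (1 < q)%N -> (d0 <= 1)%N -> (d1 <= 1)%N -> (d2 <= 1)%N -> (d3 <= 1)%N ->
  (n0 + n1 + n2 + n3 = d0 + d1 + d2 + d3)%N ->
  (n0 + n1 * q + n2 * q ^ 2 + n3 * q ^ 3 =
     d0 + d1 * q + d2 * q ^ 2 + d3 * q ^ 3 %[mod q ^ 4 - 1])%N ->
  [/\ n0 = d0, n1 = d1, n2 = d2 & n3 = d3].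
Proof.
move=> q1 h0 h1 h2 h3 hs.
(* Carries, and a wrap-around modulo [q ^ 4 - 1], are possible only for [q <= 3]. *)
have [-> |q2] := eqVneq q 2; first by move=> ?; split; lia.
have [-> |q3] := eqVneq q 3; first by move=> ?; split; lia.
have q4 : (3 < q)%N by lia.
have Q2 : (4 * q <= q ^ 2)%N by rewrite expnS expn1 leq_mul2r q4 orbT.
have Q3 : (4 * q ^ 2 <= q ^ 3)%N by rewrite (expnS q 2) leq_mul2r q4 orbT.
have Q4 : (4 * q ^ 3 <= q ^ 4)%N by rewrite (expnS q 3) leq_mul2r q4 orbT.
have leM n m : (m <= q ^ 3)%N -> (n * m <= n * q ^ 3)%N by move=> h; rewrite leq_mul2l h orbT.
have b0 := leM n0 1%N; have b1 := leM n1 q; have b2 := leM n2 (q ^ 2)%N.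
have cM d m : (d <= 1)%N -> (d * m <= m)%N by case: d => [|[]] // _; rewrite ?mul0n ?mul1n.
have c1 := cM _ q h1; have c2 := cM _ (q ^ 2)%N h2; have c3 := cM _ (q ^ 3)%N h3.
move/eq_of_modn_close => ED.
have {ED} : (n0 + q * (n1 + q * (n2 + q * n3)) = d0 + q * (d1 + q * (d2 + q * d3)))%N.
  suff: (n0 + n1 * q + n2 * q ^ 2 + n3 * q ^ 3 =
     d0 + d1 * q + d2 * q ^ 2 + d3 * q ^ 3)%N by rewrite !expnS expn0; lia.
  apply: ED; last by lia.
  (* With digit sum 4 the left side may reach [4 * q ^ 3], beyond the modulus for [q = 4]; but then
     all right digits are 1, which compensates. *)
  have [s4|s3] := eqVneq (n0 + n1 + n2 + n3)%N 4.
    have [-> -> -> ->] : [/\ d0 = 1, d1 = 1, d2 = 1 & d3 = 1]%N by split; lia.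
    have : ((n0 + n1 + n2 + n3) * q ^ 3 = 4 * q ^ 3)%N by rewrite s4.
    rewrite !mulnDl; lia.
  have : ((n0 + n1 + n2 + n3) * q ^ 3 <= 3 * q ^ 3)%N by rewrite leq_mul2r; lia.
  by rewrite !mulnDl; lia.
have digit a b A B : (a <= 3 + b)%N -> (b <= 1)%N ->
    (a + q * A = b + q * B)%N -> a = b /\ A = B.
  move=> ha hb e; have ab : a = b.
    apply: (@eq_of_modn_close q); try lia.
    by rewrite -(modnMDl A a) -(modnMDl B b) ![(_ * q)%N]mulnC addnC e addnC.
  split=> //; apply/eqP; rewrite -(eqn_pmul2l (m := q)); lia.
case/digit; [lia | lia | move=> e0].
case/digit; [lia | lia | move=> e1].
by case/digit; [lia | lia |].
Qed.

(** * Words indexing the terms of an expanded product *)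

Definition choices (I : seq nat) (n : nat) : seq (seq nat) :=
  iter n (fun T => [seq i :: e | i <- I, e <- T]) [:: [::]].

Lemma size_choices I n e : e \in choices I n -> size e = n.
Proof.
elim: n e => [|n IHn] e /=; first by rewrite inE => /eqP->.
by case/allpairsP => -[i e'] [_ /IHn <- ->].
Qed.

(* The [q]-logarithms, modulo 4, of the exponents of [x] in the product of the
   [q ^ k]-th powers of the monomials [x ^ (q ^ i)], for [k] in [d] and [i] in [e]. *)
Definition shifts (d e : seq nat) : seq nat := [seq (p.1 + p.2) %% 4 | p <- zip d e]%N.

(** The words whose monomial cancels against the product of the [x ^ (q ^ k)] for [k] in [d]; only
    these survive summation over nonzero [x]. *)
Definition balanced_choices (I d : seq nat) : seq (seq nat) :=
  [seq e <- choices I (size d) | perm_eq (shifts d e) d].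

(** * Power sums over the nonzero elements of the field *)

Section FrobeniusPolynomials.

Variables (L : finFieldType) (q : nat) (s : {rmorphism L -> L}).
Hypotheses (cardL : #|L| = (q ^ 4)%N) (sE : forall x, s x = x ^+ q).

Lemma q_gt1 : (1 < q)%N.
Proof.
have := card_finNzRing_gt1 L; rewrite cardL.
by case: q => [|[|//]]; rewrite ?exp0n ?exp1n.
Qed.

Lemma iter_frobE k x : iter k s x = x ^+ (q ^ k).
Proof. by elim: k => [|k IHk]; rewrite ?expn0 ?expr1 //= IHk sE -exprM -expnSr. Qed.

Lemma frob4 x : s (s (s (s x))) = x.
Proof. by rewrite -[LHS]/(iter 4 s x) iter_frobE -cardL expf_card. Qed.

Lemma iter_frob_mod k x : iter k s x = iter (k %% 4) s x.
Proof.
rewrite {1}(divn_eq k 4) addnC iterD; congr (iter _ _ _).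
by elim: (_ %/ _)%N => //= j IHj; rewrite frob4 -/(iter _ s x) IHj.
Qed.

Lemma expf_unit (x : L) : x != 0 -> x ^+ (q ^ 4 - 1) = 1 :> L.
Proof.
move=> x0; apply: (mulfI x0); rewrite mulr1 -exprS subn1 prednK -?cardL ?expf_card //.
exact: ltnW (card_finNzRing_gt1 L).
Qed.

(** Replacing [x] by [y * x] multiplies the sum by [y ^+ E / y ^+ D]. This is not 1 for some [y]: a
    nonzero polynomial of degree below [q ^ 4 - 1] cannot vanish at every nonzero element. *)
Lemma sum_expf_ratio_eq0 E D :
  E <> D %[mod q ^ 4 - 1] -> \sum_(x : L | x != 0) x ^+ E / x ^+ D = 0.
Proof.
move=> neqED; set m := (q ^ 4 - 1)%N in neqED.
have m_gt0 : (0 < m)%N by rewrite /m -cardL subn_gt0 card_finNzRing_gt1.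
have expm k (x : L) : x != 0 -> x ^+ k = x ^+ (k %% m).
  move=> x0; rewrite {1}(divn_eq k m) exprD mulnC exprM expf_unit //.
  by rewrite expr1n mul1r.
have [y y0 neqy] : exists2 y : L, y != 0 & y ^+ E != y ^+ D.
  pose P : {poly L} := 'X^(E %% m) - 'X^(D %% m).
  have P0 : P != 0.
    apply/eqP => /(congr1 (fun p : {poly L} => p`_(E %% m))).
    rewrite coefB !coefXn eqxx coef0; case: eqP => // _ /eqP.
    by rewrite subr0 oner_eq0.
  have szP : (size P <= m)%N.
    by rewrite (leq_trans (size_polyD _ _)) // size_polyN !size_polyXn geq_max !ltn_pmod.
  have [/forall_inP alle|/forall_inPn[y]] := boolP [forall (y : L | y != 0), y ^+ E == y ^+ D].
    have rootsP : all (root P) (enum [set~ (0 : L)]).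
      apply/allP => x; rewrite mem_enum !inE => x0.
      by rewrite /root hornerD hornerN !hornerXn -!expm // subr_eq0 alle.
    have := max_poly_roots P0 rootsP (enum_uniq _).
    by rewrite -cardE cardsC1 cardL -subn1 -/m ltnNge szP.
  by exists y.
set S := \sum_(x | _) _.
have eS : S = (y ^+ E / y ^+ D) * S.
  rewrite {1}/S (reindex_onto (fun x => y * x) (fun x => y^-1 * x)) /=; last first.
    by move=> x _; rewrite mulVKf.
  rewrite mulr_sumr; apply: eq_big => [x|x _].
    by rewrite mulKf // eqxx andbT mulf_eq0 (negPf y0).
  by rewrite !exprMn invfM mulrACA.
apply: contraNeq neqy => S0; rewrite -subr_eq0.
have yD0 : y ^+ D != 0 by rewrite expf_neq0.
have /(mulIf S0) e1 : (y ^+ E / y ^+ D) * S = 1 * S by rewrite mul1r -eS.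
by rewrite subr_eq0; apply/eqP; rewrite -[LHS](divfK yD0) e1 mul1r.
Qed.

(** Translation by [x0] permutes [K], yet adds [#|K|] times [x0] to the sum of its elements. *)
Lemma card_translation_invariant (K : {set L}) x0 :
  x0 != 0 -> (forall x, (x + x0 \in K) = (x \in K)) -> #|K|%:R = 0 :> L.
Proof.
move=> nz_x0 invK; apply: (mulIf nz_x0); rewrite mul0r mulr_natl.
apply: (@addrI _ (\sum_(x in K) x)); rewrite addr0 -sumr_const -big_split /=.
rewrite [RHS](reindex_onto (fun x => x + x0) (fun x => x - x0)) => [|x _] /=.
  by apply: eq_bigl => x; rewrite invK addrK eqxx andbT.
by rewrite subrK.
Qed.

Lemma sum_nonzero1 : \sum_(x : L | x != 0) 1 = -1 :> L.
Proof.
have := @card_translation_invariant setT 1 (oner_neq0 _).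
rewrite -sum1_card natr_sum => sumT.
have {sumT} := sumT (fun x => etrans (in_setT _) (esym (in_setT _))).
under eq_bigl do rewrite inE.
by rewrite (bigD1 0) //= => /eqP; rewrite addrC addr_eq0 => /eqP.
Qed.

(** Numerator and denominator are powers of [x] whose exponents have the multiplicities in [r] and
    [d] as base-[q] digits; those of [d] are at most 1, so [base_digits_eq] applies. *)
Lemma sum_frob_monomial (r d : seq nat) :
  all (gtn 4) r -> all (gtn 4) d -> uniq d -> size r = size d ->
  \sum_(x : L | x != 0) (\prod_(i <- r) iter i s x) / (\prod_(i <- d) iter i s x)
    = if perm_eq r d then -1 else 0.
Proof.
move=> r4 d4 uniq_d size_rd; case: ifPn => [eq_rd | neq_rd].
  rewrite -sum_nonzero1; apply: eq_bigr => x x0; rewrite (perm_big d) //= divff //.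
  by rewrite prodf_seq_neq0; apply/allP => i _ /=; rewrite iter_frobE expf_neq0.
have prodE (t : seq nat) x : \prod_(i <- t) iter i s x = x ^+ (\sum_(i <- t) q ^ i)%N.
  by rewrite expr_sum; apply: eq_bigr => i _; rewrite iter_frobE.
under eq_bigr do rewrite !prodE.
pose n (t : seq nat) i := count_mem i t.
have sumE t : all (gtn 4) t ->
    (\sum_(i <- t) q ^ i = n t 0 + n t 1 * q + n t 2 * q ^ 2 + n t 3 * q ^ 3)%N /\
    (size t = n t 0 + n t 1 + n t 2 + n t 3)%N.
  elim: t => [|i t IHt] /=; first by rewrite big_nil; lia.
  case/andP=> i4 /IHt[e1 e2]; rewrite big_cons e1 e2.
  by case: i i4 => [|[|[|[|]]]] //= _; split; rewrite ?expn0 ?expn1; lia.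
have [[Er sr] [Ed sd]] := (sumE r r4, sumE d d4).
have nd i : (n d i <= 1)%N by rewrite /n count_uniq_mem // leq_b1.
apply: sum_expf_ratio_eq0; rewrite Er Ed => /base_digits_eq.
case; rewrite ?q_gt1 ?nd -?sr -?sd //.
move=> e0 e1 e2 e3; case/negP: neq_rd; apply/allP => i; rewrite mem_cat => i_rd /=; apply/eqP.
have : (i < 4)%N by case/orP: i_rd => [/(allP r4) | /(allP d4)].
by case: i {i_rd} => [|[|[|[|]]]].
Qed.

Lemma iter_frob0 k : iter k s 0 = 0.
Proof. by elim: k => //= k ->; rewrite rmorph0. Qed.

Lemma iter_frobD k : {morph iter k s : x y / x + y}.
Proof. by move=> x y; elim: k => //= k ->; rewrite rmorphD. Qed.

Lemma iter_frobM k : {morph iter k s : x y / x * y}.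
Proof. by move=> x y; elim: k => //= k ->; rewrite rmorphM. Qed.

Lemma iter_frobV k : {morph iter k s : x / x^-1}.
Proof. by move=> x; elim: k => //= k ->; rewrite fmorphV. Qed.

Definition frob_coef (a : nat -> L) (d e : seq nat) : L :=
  \prod_(p <- zip d e) iter p.1 s (a p.2).

Lemma prod_frob_choices a (I d : seq nat) x :
  \prod_(k <- d) iter k s (\sum_(i <- I) a i * iter i s x) =
  \sum_(e <- choices I (size d)) frob_coef a d e * \prod_(j <- shifts d e) iter j s x.
Proof.
elim: d => [|k d IHd] /=.
  by rewrite big_nil big_seq1 /frob_coef /shifts /= !big_nil mulr1.
rewrite big_cons IHd big_allpairs_dep /= (big_morph _ (iter_frobD k) (iter_frob0 k)).
rewrite mulr_suml; apply: eq_bigr => i _; rewrite mulr_sumr; apply: eq_bigr => e _.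
rewrite /frob_coef /shifts /= !big_cons iter_frobM -iterD -(iter_frob_mod (k + i)) mulrACA.
by rewrite -!mulrA.
Qed.

Lemma sum_frob_ratio a (I d : seq nat) : all (gtn 4) d -> uniq d ->
  \sum_(x | x != 0) \prod_(k <- d) iter k s ((\sum_(i <- I) a i * iter i s x) / x) =
  - \sum_(e <- balanced_choices I d) frob_coef a d e.
Proof.
move=> d4 uniq_d.
have expand x : \prod_(k <- d) iter k s ((\sum_(i <- I) a i * iter i s x) / x) =
    \sum_(e <- choices I (size d))
      frob_coef a d e * ((\prod_(j <- shifts d e) iter j s x) / \prod_(k <- d) iter k s x).
  under eq_bigr do rewrite iter_frobM iter_frobV.
  rewrite big_split /= prod_frob_choices prodfV mulr_suml.
  by apply: eq_bigr => t _; rewrite mulrA.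
under eq_bigr do rewrite expand.
rewrite exchange_big /= -sumrN big_filter big_mkcond /= [RHS]big_mkcond /=.
rewrite !big_seq; apply: eq_bigr => e /size_choices sz.
rewrite -mulr_sumr sum_frob_monomial //; first by case: ifP; rewrite ?mulrN1 ?mulr0.
  by rewrite all_map; apply/allP => p _; rewrite /= ltn_pmod.
by rewrite size_map size_zip sz minnn.
Qed.

(** * q-polynomials and the identities forced by equal eigenvalues *)

Definition qpoly (a : nat -> L) (x : L) : L :=
  a 0 * x + a 1 * s x + a 2 * s (s x) + a 3 * s (s (s x)).

Lemma qpolyE a x : qpoly a x = \sum_(i <- iota 0 4) a i * iter i s x.
Proof. by rewrite /= !big_cons big_nil /= addr0 !addrA. Qed.

Lemma qpolyD a : {morph qpoly a : x y / x + y}.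
Proof. by move=> x y; rewrite /qpoly; ring. Qed.

Lemma sum_qpoly_ratio a : \sum_(x | x != 0) qpoly a x / x = - a 0.
Proof.
have := @sum_frob_ratio a (iota 0 4) [:: 0%N] isT isT.
rewrite (_ : balanced_choices _ _ = [:: [:: 0%N]]) // big_seq1 /frob_coef /= big_seq1 => <-.
by apply: eq_bigr => x _; rewrite big_seq1 qpolyE.
Qed.

Definition eigenb (f : L -> L) m := [exists x, (x != 0) && (f x == m * x)].

(* A nonzero eigenspace has order divisible by the characteristic, so each eigenvalue is
   attained [-1] times, modulo the characteristic. *)
Lemma sum_eigen (f phi : L -> L) : {morph f : x y / x + y} ->
  \sum_(x | x != 0) phi (f x / x) = - \sum_(m | eigenb f m) phi m.
Proof.
move=> fD; have f0 : f 0 = 0 by apply: (addrI (f 0)); rewrite -fD !addr0.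
rewrite (partition_big (fun x => f x / x) (eigenb f)) /=; last first.
  by move=> x x0; apply/existsP; exists x; rewrite x0 divfK /=.
rewrite -sumrN; apply: eq_bigr => m /existsP[x0 /andP[nz_x0 /eqP fx0]].
pose K := [set x | f x == m * x].
have K0 : #|K|%:R = 0 :> L.
  apply: (card_translation_invariant nz_x0) => x.
  by rewrite !inE fD fx0 mulrDr (inj_eq (addIr _)).
rewrite (eq_bigr (fun=> phi m * 1)) => [|x /andP[_ /eqP->]]; last by rewrite mulr1.
rewrite -mulr_sumr (eq_bigl (mem (K :\ 0))) => [|x]; last first.
  rewrite !inE; case: eqP => //= /eqP nz_x.
  by apply/eqP/eqP => [<-|->]; rewrite ?divfK ?mulfK.
rewrite sumr_const; have := cardsD1 0 K; rewrite inE f0 mulr0 eqxx => cK.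
by move/eqP: K0; rewrite cK natrD addrC addr_eq0 => /eqP->; rewrite mulrN1.
Qed.

Definition frob_norm x := x * s x * s (s x) * s (s (s x)).

Lemma frob_normM : {morph frob_norm : x y / x * y}.
Proof. by move=> x y; rewrite /frob_norm; ring. Qed.

Lemma frob_norm_frob x : frob_norm (s x) = frob_norm x.
Proof. by rewrite /frob_norm frob4; ring. Qed.

Section SameEigenvalues.

Variables a b : nat -> L.
Hypothesis eq_eigen : eigenb (qpoly a) =1 eigenb (qpoly b).

Lemma eq_sum_qpoly_ratio (phi : L -> L) :
  \sum_(x | x != 0) phi (qpoly a x / x) = \sum_(x | x != 0) phi (qpoly b x / x).
Proof.
by rewrite !sum_eigen; [rewrite (eq_bigl _ _ eq_eigen) | exact: qpolyD..].
Qed.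

Lemma eq_coef0 : a 0 = b 0.
Proof. by apply: oppr_inj; rewrite -!sum_qpoly_ratio (eq_sum_qpoly_ratio id). Qed.

(** Here [phi m] is the product of the [q ^ k]-th powers of [m - a 0], so index 0 drops out. Letting
    [I] omit vanishing coefficients shortens the list of words. *)
Lemma eq_sum_frob_coef (I d : seq nat) :
  {in iota 1 3, forall i, i \notin I -> a i = 0 /\ b i = 0} ->
  uniq I -> {subset I <= iota 1 3} -> all (gtn 4) d -> uniq d ->
  \sum_(e <- balanced_choices I d) frob_coef a d e =
  \sum_(e <- balanced_choices I d) frob_coef b d e.
Proof.
move=> outI uI sI d4 uniq_d; apply: oppr_inj; rewrite -!sum_frob_ratio //.
have ratioE c x : (forall i, i \in iota 1 3 -> i \notin I -> c i = 0) -> x != 0 ->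
    (\sum_(i <- I) c i * iter i s x) / x = qpoly c x / x - c 0.
  move=> c0 x0; rewrite qpolyE -[iota 0 4]/(0%N :: iota 1 3) [in RHS]big_cons mulrDl mulfK //.
  rewrite [RHS]addrC addKr; congr (_ / _).
  transitivity (\sum_(i <- iota 1 3 | i \in I) c i * iter i s x).
    rewrite -[RHS]big_filter; apply: perm_big; apply: uniq_perm; rewrite ?filter_uniq // => i.
    by rewrite mem_filter; apply/idP/andP => [iI | [] //]; split=> //; apply: sI.
  rewrite big_mkcond !big_seq; apply: eq_bigr => i i3.
  by case: ifPn => // /(c0 i i3) ->; rewrite mul0r.
pose phi m := \prod_(k <- d) iter k s (m - a 0).
transitivity (\sum_(x | x != 0) phi (qpoly a x / x)).
  by apply: eq_bigr => x x0; rewrite /phi ratioE // => i i3 /(outI i i3)[].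
rewrite eq_sum_qpoly_ratio.
by apply: eq_bigr => x x0; rewrite /phi eq_coef0 ratioE // => i i3 /(outI i i3)[].
Qed.

Lemma eq_coef13 : a 1 * s (a 3) = b 1 * s (b 3).
Proof.
have := @eq_sum_frob_coef (iota 1 3) [:: 0; 1]%N.
rewrite (_ : balanced_choices _ _ = [:: [:: 1; 3]]%N) // !big_seq1.
by rewrite /frob_coef !big_cons !big_nil /= !mulr1; apply=> // i ->.
Qed.

Lemma eq_coef22 : a 2 * s (s (a 2)) = b 2 * s (s (b 2)).
Proof.
have := @eq_sum_frob_coef (iota 1 3) [:: 0; 2]%N.
rewrite (_ : balanced_choices _ _ = [:: [:: 2; 2]]%N) // !big_seq1.
by rewrite /frob_coef !big_cons !big_nil /= !mulr1; apply=> // i ->.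
Qed.

Lemma eq_coef123 :
  a 1 * s (a 1) * s (s (a 2)) + a 2 * s (a 3) * s (s (a 3)) =
  b 1 * s (b 1) * s (s (b 2)) + b 2 * s (b 3) * s (s (b 3)).
Proof.
have := @eq_sum_frob_coef (iota 1 3) [:: 0; 1; 2]%N.
rewrite (_ : balanced_choices _ _ = [:: [:: 1; 1; 2]; [:: 2; 3; 3]]%N) //.
rewrite !big_cons !big_nil /frob_coef !big_cons !big_nil /= !addr0 !mulr1 !mulrA.
by apply=> // i ->.
Qed.

(** The two mixed words contribute products of conjugates of [a 1 * s (a 3)], which agree by
    [eq_coef13]; the other two give the norms. *)
Lemma eq_coef_norm : a 2 = 0 -> b 2 = 0 ->
  frob_norm (a 1) + frob_norm (a 3) = frob_norm (b 1) + frob_norm (b 3).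
Proof.
move=> a20 b20; have := @eq_sum_frob_coef [:: 1; 3]%N (iota 0 4).
rewrite (_ : balanced_choices _ _ =
  [:: [:: 1; 1; 1; 1]; [:: 1; 3; 1; 3]; [:: 3; 1; 3; 1]; [:: 3; 3; 3; 3]]%N) //.
rewrite !big_cons !big_nil /frob_coef !big_cons !big_nil /= !addr0 !mulr1.
have outI : {in iota 1 3, forall i, i \notin [:: 1; 3]%N -> a i = 0 /\ b i = 0}.
  by move=> i; rewrite !inE => /or3P[] /eqP->.
have subI : {subset [:: 1; 3]%N <= iota 1 3} by move=> i; rewrite !inE => /orP[] /eqP->.
move/(_ outI isT subI isT isT) => e.
have e0 := eq_coef13; have e1 := congr1 s e0; have e2 := congr1 s e1; have e3 := congr1 s e2.
rewrite !rmorphM ?frob4 /= in e1 e2 e3.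
have e02 := congr2 *%R e0 e2; have e13 := congr2 *%R e1 e3.
have normE (c : nat -> L) : frob_norm (c 1) + frob_norm (c 3) = 
      c 1 * (s (c 1) * (s (s (c 1)) * s (s (s (c 1))))) +
      (c 1 * (s (c 3) * (s (s (c 1)) * s (s (s (c 3))))) +
      (c 3 * (s (c 1) * (s (s (c 3)) * s (s (s (c 1))))) +
      c 3 * (s (c 3) * (s (s (c 3)) * s (s (s (c 3)))))))
    - c 1 * s (c 3) * (s (s (c 1)) * s (s (s (c 3))))
    - s (c 1) * s (s (c 3)) * (s (s (s (c 1))) * c 3).
  by rewrite /frob_norm; ring.
by rewrite (normE a) (normE b) e e02 e13.
Qed.

End SameEigenvalues.

Definition ftrace x := x + s x + s (s x) + s (s (s x)).

Lemma ftraceE x : ftrace x = trace q 4 x.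
Proof. by rewrite /trace !big_ord_recl big_ord0 /= -!iter_frobE /= addr0 !addrA. Qed.

Lemma ftrace_frob x : s (ftrace x) = ftrace x.
Proof. by rewrite /ftrace; rewrite !rmorphD /= frob4; ring. Qed.

(* Since [Tr t] lies in F_q, F_q-linearity moves the sum of [f (x / t) * Tr t] inside [f],
   where it becomes [x] times the sum of [Tr t / t], namely [- x]. *)
Lemma Fq_linear_qpoly (f : L -> L) :
  {morph f : x y / x + y} -> (forall c x, s c = c -> f (c * x) = c * f x) ->
  exists a, f =1 qpoly a.
Proof.
move=> fD fZ; have f0 : f 0 = 0 by apply: (addrI (f 0)); rewrite -fD !addr0.
have sum_tr : \sum_(t | t != 0) ftrace t / t = -1.
  rewrite -(sum_qpoly_ratio (fun=> 1)); apply: eq_bigr => t _; rewrite /qpoly !mul1r.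
  by rewrite /ftrace.
(* Substituting [x / t] for [t] makes [f x] minus the sum of [ftrace (x / t) * f t]; expanding the
   trace gives these coefficients. *)
exists (fun k => - \sum_(t | t != 0) f t / iter k s t) => x.
have -> : f x = - \sum_(t | t != 0) ftrace t * f (x / t).
  have -> : \sum_(t | t != 0) ftrace t * f (x / t) = f (\sum_(t | t != 0) ftrace t * (x / t)).
    by rewrite (big_morph _ fD f0); apply: eq_bigr => t _; rewrite [RHS]fZ ?ftrace_frob.
  under eq_bigr do rewrite mulrCA.
  rewrite -mulr_sumr sum_tr mulrN1; apply/eqP; rewrite -addr_eq0 -fD subrr f0 //.
have [-> | x0] := eqVneq x 0.
  rewrite /qpoly !rmorph0 !mulr0 !addr0 big1 ?oppr0 // => t _; by rewrite mul0r f0 mulr0.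
rewrite (reindex_onto (fun t => x / t) (fun t => x / t)) /=; last first.
  by move=> t t0; rewrite invf_div mulrCA divff ?mulr1.
rewrite /qpoly /= !mulNr -!opprD; congr (- _).
rewrite !mulr_suml -!big_split /=; apply: eq_big => [t | t /andP[]].
  rewrite mulf_eq0 invr_eq0 (negPf x0) /=; case: eqP => //= /eqP t0.
  by rewrite invf_div mulrCA divff ?mulr1 ?eqxx.
rewrite mulf_eq0 invr_eq0 (negPf x0) /= => t0 _.
rewrite invf_div (mulrCA x t) divff // mulr1 /ftrace !fmorph_div /=; ring.
Qed.

(** [sum_qpoly_ratio] isolates [a 0]; applying [s] three times rotates the coefficients, up to
    conjugation, and brings the next one to index 0. *)
Lemma qpoly_eq0 a : (forall x, qpoly a x = 0) -> forall i, (i < 4)%N -> a i = 0.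
Proof.
move=> a0 i; elim: i a a0 => [|i IHi] a a0 i4.
  apply: oppr_inj; rewrite -sum_qpoly_ratio oppr0.
  by apply: big1 => x _; rewrite a0 mul0r.
apply: (fmorph_inj s); apply: (fmorph_inj s); apply: (fmorph_inj s); rewrite !rmorph0.
rewrite -(IHi (fun j => s (s (s (a (j.+1 %% 4)%N))))) ?modn_small ?(ltnW i4) // => x.
by rewrite -[RHS](rmorph0 (s \o s \o s)) -(a0 x) /qpoly /= !rmorphD !rmorphM /= !frob4; ring.
Qed.

Lemma ftrace_nondeg z : (forall x, ftrace (x * z) = 0) -> z = 0.
Proof.
move=> tr0; apply: (@qpoly_eq0 (fun i => iter i s z) _ 0%N isT) => x.
by rewrite -(tr0 x) /qpoly /ftrace /=; rewrite !rmorphM /=; ring.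
Qed.

Lemma hilbert90 u : frob_norm u = 1 -> exists2 l, l != 0 & s l = u * l.
Proof.
move=> Nu; have u0 : u != 0.
  by apply: contra_eq_neq Nu => ->; rewrite /frob_norm !mul0r eq_sym oner_eq0.
(* Lagrange resolvent: [s (c i) = u * c (i + 1)], with indices modulo 4 because [u] has norm 1. It
   is not identically zero since [c 0 = 1]. *)
pose c i := nth 0 [:: 1; u^-1; (u * s u)^-1; (u * s u * s (s u))^-1] i.
have [/forallP c0 | /forallPn[x nz]] := boolP [forall x, qpoly c x == 0].
  have /(_ 0%N isT)/eqP := @qpoly_eq0 c (fun x => eqP (c0 x)).
  by rewrite oner_eq0.
exists (qpoly c x) => //; rewrite /qpoly /c /= !rmorphD !rmorphM !fmorphV !rmorphM rmorph1 frob4 /=.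
have su0 : s u != 0 by rewrite fmorph_eq0.
have ssu0 : s (s u) != 0 by rewrite fmorph_eq0.
have -> : (s u * s (s u) * s (s (s u)))^-1 = u.
  by apply: (mulIf (invr_neq0 u0)); rewrite divff // -invfM mulrC !mulrA -/(frob_norm u) Nu invr1.
rewrite !invfM; field; do ?[apply/andP; split => //].
Qed.

(** * Adjoints, twists and recovery of the scalar from the invariants *)

Definition adj (a : nat -> L) (i : nat) : L := iter i s (a ((4 - i) %% 4)%N).

(** Says that [b] represents [x |-> l^-1 * f (l * x)], where [a] represents [f], with denominators
    cleared. *)
Definition is_twist (a b : nat -> L) (l : L) : Prop :=
  [/\ b 0 = a 0, b 1 * l = a 1 * s l, b 2 * l = a 2 * s (s l) & b 3 * l = a 3 * s (s (s l))].

Definition same_invariants (a b : nat -> L) : Prop :=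
  [/\ a 0 = b 0, a 1 * s (a 3) = b 1 * s (b 3), a 2 * s (s (a 2)) = b 2 * s (s (b 2)),
      a 1 * s (a 1) * s (s (a 2)) + a 2 * s (a 3) * s (s (a 3)) =
      b 1 * s (b 1) * s (s (b 2)) + b 2 * s (b 3) * s (s (b 3)) &
      a 2 = 0 -> b 2 = 0 ->
      frob_norm (a 1) + frob_norm (a 3) = frob_norm (b 1) + frob_norm (b 3)].

Lemma same_eigen_invariants a b :
  eigenb (qpoly a) =1 eigenb (qpoly b) -> same_invariants a b.
Proof.
by move=> e; split; [exact: eq_coef0 | exact: eq_coef13 | exact: eq_coef22
                   | exact: eq_coef123 | exact: eq_coef_norm].
Qed.

Lemma same_invariants_adj a b : same_invariants a b -> same_invariants (adj a) b.
Proof.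
case=> e0 e13 e22 e123 eN; rewrite /adj; split=> //=.
- by rewrite frob4 mulrC.
- by rewrite frob4 mulrC.
- by rewrite -e123 !frob4; ring.
- move=> /eqP; rewrite !fmorph_eq0 => /eqP a20 /(eN a20) <-.
  by rewrite !frob_norm_frob addrC.
Qed.

Lemma sum_prod_eq (u v u' v' : L) :
  u + v = u' + v' -> u * v = u' * v' -> u = u' \/ u = v'.
Proof.
move=> eD eM; have : (u - u') * (u - v') = 0.
  have -> : (u - u') * (u - v') = u * (u - (u' + v')) + u' * v' by ring.
  by rewrite -eD -eM; ring.
by move/eqP; rewrite mulf_eq0 !subr_eq0 => /orP[] /eqP; [left | right].
Qed.

Lemma frob_norm_neq0 x : x != 0 -> frob_norm x != 0.
Proof. by move=> x0; rewrite !mulf_neq0 ?fmorph_eq0. Qed.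

(** Hilbert 90 writes [b 1 / a 1] as [s l / l], the relation at index 1. Cancelling it from the two
    product identities leaves conjugates of the relations at indices 3 and 2. *)
Lemma twist_of_norm (a b : nat -> L) : a 1 != 0 -> a 0 = b 0 -> frob_norm (a 1) = frob_norm (b 1) ->
  a 1 * s (a 3) = b 1 * s (b 3) ->
  a 1 * s (a 1) * s (s (a 2)) = b 1 * s (b 1) * s (s (b 2)) ->
  exists2 l, l != 0 & is_twist a b l.
Proof.
move=> a1 e0 eN e13 e12.
have Na := frob_norm_neq0 a1.
have b1 : b 1 != 0.
  by apply: contraNneq Na => b1; rewrite eN b1 /frob_norm !mul0r.
have Nu : frob_norm (b 1 / a 1) = 1.
  by apply: (mulIf Na); rewrite -frob_normM divfK // mul1r eN.
have [l l0 sl] := hilbert90 Nu; exists l => //.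
have e1 : b 1 * l = a 1 * s l by rewrite sl mulrA mulrCA divff // mulr1.
have s1l : s l != 0 by rewrite fmorph_eq0.
have e3 : s (b 3) * s l = s (a 3) * l.
  apply: (mulfI (mulf_neq0 b1 l0)).
  have -> : b 1 * l * (s (b 3) * s l) = (b 1 * s (b 3)) * (l * s l) by ring.
  by rewrite -e13 e1; ring.
have e2 : s (s (b 2)) * s (s l) = s (s (a 2)) * l.
  have e1s := congr1 s e1; rewrite !rmorphM /= in e1s.
  have nz : b 1 * l * (s (b 1) * s l) != 0 by rewrite !mulf_neq0 ?fmorph_eq0.
  apply: (mulfI nz).
  have -> : b 1 * l * (s (b 1) * s l) * (s (s (b 2)) * s (s l)) =
    (b 1 * s (b 1) * s (s (b 2))) * (l * s l * s (s l)) by ring.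
  by rewrite -e12 e1 e1s; ring.
split=> //.
- by have := congr1 (s \o s) e2; rewrite /= !rmorphM /= !frob4.
- by have := congr1 (s \o s \o s) e3; rewrite /= !rmorphM /= !frob4.
Qed.

(** The adjoint of [x |-> l^-1 * f (l * x)] is [x |-> l * f' (l^-1 * x)], with [f'] the adjoint of
    [f]. *)
Lemma twist_adj a b l : l != 0 -> is_twist a (adj b) l -> is_twist (adj a) b l^-1.
Proof.
move=> l0 [/= e0 e1 e2 e3].
have flip (u v k k' : L) : k != 0 -> k' != 0 -> u * k' = v * k -> u * k^-1 = v * k'^-1.
  by move=> k0 k'0 e; apply: (mulIf k'0); apply: (mulIf k0);
     rewrite divfK // mulrAC divfK.
split=> //=; rewrite !fmorphV; apply: flip; rewrite ?fmorph_eq0 //.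
- by have := congr1 s e3; rewrite !rmorphM /= !frob4.
- by have := congr1 (s \o s) e2; rewrite /= !rmorphM /= !frob4.
- by have := congr1 (s \o s \o s) e1; rewrite /= !rmorphM /= !frob4.
Qed.

(** For [z = a 1 * s (a 1) * s (s (a 2))], the product [z * s (s z)] is [frob_norm (a 1)] times
    [a 2 * s (s (a 2))]. *)
Lemma frob_norm_eq (a b : nat -> L) : a 2 != 0 -> a 2 * s (s (a 2)) = b 2 * s (s (b 2)) ->
  a 1 * s (a 1) * s (s (a 2)) = b 1 * s (b 1) * s (s (b 2)) ->
  frob_norm (a 1) = frob_norm (b 1).
Proof.
move=> a2 e22 e12.
have a22 : a 2 * s (s (a 2)) != 0 by rewrite mulf_neq0 ?fmorph_eq0.
have normE (c : nat -> L) : frob_norm (c 1) * (c 2 * s (s (c 2))) =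
    (c 1 * s (c 1) * s (s (c 2))) * s (s (c 1 * s (c 1) * s (s (c 2)))).
  by rewrite /frob_norm !rmorphM /= !frob4; ring.
by apply: (mulIf a22); rewrite normE e12 -normE e22.
Qed.

Lemma twist_of_invariants_coef1 a b : same_invariants a b -> a 1 != 0 ->
  exists2 l, l != 0 & is_twist a b l \/ is_twist (adj a) b l.
Proof.
case=> e0 e13 e22 e123 eN a1.
have e13' : a 1 * s (a 3) = adj b 1 * s (adj b 3) by rewrite /adj /= frob4 e13 mulrC.
have direct : frob_norm (a 1) = frob_norm (b 1) ->
    a 1 * s (a 1) * s (s (a 2)) = b 1 * s (b 1) * s (s (b 2)) ->
    exists2 l, l != 0 & is_twist a b l \/ is_twist (adj a) b l.
  by move=> eN1 e12; have [l] := twist_of_norm a1 e0 eN1 e13 e12; exists l; auto.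
(* A crosswise match of the two quantities is a direct match with [adj b]. *)
have dual : frob_norm (a 1) = frob_norm (adj b 1) ->
    a 1 * s (a 1) * s (s (a 2)) = adj b 1 * s (adj b 1) * s (s (adj b 2)) ->
    exists2 l, l != 0 & is_twist a b l \/ is_twist (adj a) b l.
  move=> eN1 e12; have [l l0 tw] := twist_of_norm a1 (b := adj b) e0 eN1 e13' e12.
  by exists l^-1; rewrite ?invr_eq0 //; right; apply: twist_adj.
have [a20 | a2] := eqVneq (a 2) 0.
  have b20 : b 2 = 0.
    by move/esym/eqP: e22; rewrite a20 mul0r mulf_eq0 !fmorph_eq0 orbb => /eqP.
  have eM : frob_norm (a 1) * frob_norm (a 3) = frob_norm (b 1) * frob_norm (b 3).
    by rewrite -(frob_norm_frob (a 3)) -(frob_norm_frob (b 3)) -!frob_normM e13.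
  case: (sum_prod_eq (eN a20 b20) eM) => eN1.
    by apply: direct; rewrite // a20 b20 !rmorph0 !mulr0.
  by apply: dual; rewrite /adj /= ?frob_norm_frob // a20 b20 !rmorph0 !mulr0.
have eM : a 1 * s (a 1) * s (s (a 2)) * (a 2 * s (a 3) * s (s (a 3))) =
          b 1 * s (b 1) * s (s (b 2)) * (b 2 * s (b 3) * s (s (b 3))).
  have E (c : nat -> L) : c 1 * s (c 1) * s (s (c 2)) * (c 2 * s (c 3) * s (s (c 3))) =
      (c 1 * s (c 3)) * s (c 1 * s (c 3)) * (c 2 * s (s (c 2))).
    by rewrite rmorphM /=; ring.
  by rewrite !E e13 e22.
case: (sum_prod_eq e123 eM) => e12.
  by apply: direct => //; apply: frob_norm_eq.
have e12' : a 1 * s (a 1) * s (s (a 2)) = adj b 1 * s (adj b 1) * s (s (adj b 2)).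
  by rewrite e12 /adj /= !frob4; ring.
by apply: dual => //; apply: frob_norm_eq => //; rewrite e22 /adj /= !frob4 mulrC.
Qed.

(** When [a 3] is nonzero, pass to [adj a], whose coefficient 1 is [s (a 3)]; a second adjoint
    restores [a], so the alternatives swap. *)
Lemma twist_of_invariants a b : same_invariants a b -> (a 1 != 0) || (a 3 != 0) ->
  exists2 l, l != 0 & is_twist a b l \/ is_twist (adj a) b l.
Proof.
move=> inv /orP[a1 | a3]; first exact: twist_of_invariants_coef1.
have [|l l0 tw] := twist_of_invariants_coef1 (same_invariants_adj inv).
  by rewrite /adj /= fmorph_eq0.
exists l => //; case: tw => tw; [by right | left].
by case: tw => e0 e1 e2 e3; split; rewrite ?e0 ?e1 ?e2 ?e3 /adj /= ?frob4.
Qed.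

Lemma qpoly_twist a b l x : l != 0 -> is_twist a b l -> qpoly b x = l^-1 * qpoly a (l * x).
Proof.
move=> l0 [e0 e1 e2 e3]; apply: (mulfI l0); rewrite mulVKf // /qpoly !rmorphM /=.
transitivity (b 0 * l * x + b 1 * l * s x + b 2 * l * s (s x) + b 3 * l * s (s (s x))).
  by ring.
by rewrite e0 e1 e2 e3; ring.
Qed.

Lemma ftrace_adj a x y : ftrace (qpoly a x * y) = ftrace (x * qpoly (adj a) y).
Proof. by rewrite /ftrace /qpoly /adj /= !rmorphM !rmorphD !rmorphM /= !frob4; ring. Qed.

Lemma adjK a i : (i < 4)%N -> adj (adj a) i = a i.
Proof. by case: i => [|[|[|[|]]]] // _; rewrite /adj /= ?frob4. Qed.

(* An injective [f - m] is onto, so that the kernel of its adjoint is orthogonal to all of [L]. *)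
Lemma eigen_adj_sub a m : eigenb (qpoly (adj a)) m -> eigenb (qpoly a) m.
Proof.
move=> /existsP[y /andP[y0 /eqP ey]]; apply: contraNT y0 => /existsPn no_eigen.
have inj : injective (fun x => qpoly a x - m * x).
  move=> x z /= exz; apply/eqP; rewrite -subr_eq0.
  apply: contraNT (no_eigen (x - z)) => -> /=; rewrite -subr_eq0.
  have -> : qpoly a (x - z) - m * (x - z) = (qpoly a x - m * x) - (qpoly a z - m * z).
    by rewrite /qpoly; ring.
  by rewrite exz subrr.
have [g _ gK] := injF_bij inj.
apply/eqP/ftrace_nondeg => z; rewrite -(gK z).
have -> : (qpoly a (g z) - m * g z) * y = qpoly a (g z) * y - g z * (m * y) by ring.
have trB u v : ftrace (u - v) = ftrace u - ftrace v by rewrite /ftrace; ring.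
by rewrite trB ftrace_adj ey subrr.
Qed.

Lemma eigen_adj a : eigenb (qpoly (adj a)) =1 eigenb (qpoly a).
Proof.
move=> m; apply/idP/idP; first exact: eigen_adj_sub.
move=> em; apply: eigen_adj_sub; congr (is_true _): em.
by apply: eq_existsb => x; rewrite /qpoly !adjK.
Qed.

End FrobeniusPolynomials.

(** * Points and linear sets of the projective line in coordinates *)

Section LinearSets.

Variable L : finFieldType.
Implicit Types (u v w : L * L) (X Y : {set L * L}).

Definition det2 u v : L := u.1 * v.2 - v.1 * u.2.

Lemma vscaleA (c d : L) u : vscale c (vscale d u) = vscale (c * d) u.
Proof. by rewrite /vscale /= !mulrA. Qed.

Lemma vscale1 u : vscale 1 u = u.
Proof. by case: u => x y; rewrite /vscale /= !mul1r. Qed.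

Lemma vscale_eq0 (c : L) u : c != 0 -> (vscale c u == (0, 0)) = (u == (0, 0)).
Proof. by case: u => x y c0; rewrite /vscale /= !xpair_eqE !mulf_eq0 (negPf c0). Qed.

Lemma pt_vscale (c : L) u : c != 0 -> pt (vscale c u) = pt u.
Proof.
move=> c0; apply/setP => z; apply/imsetP/imsetP => -[d _ ->].
  by exists (d * c); rewrite ?vscaleA.
by exists (d / c); rewrite ?vscaleA ?divfK.
Qed.

Lemma pt_linsetP X v : v != (0, 0) ->
  reflect (exists2 c, c != 0 & vscale c v \in X) (pt v \in linset X).
Proof.
move=> v0; apply: (iffP imsetP) => [[u] | [c c0 cvX]]; last first.
  by exists (vscale c v); rewrite ?pt_vscale // !inE vscale_eq0 // v0.
rewrite !inE => /andP[u0 uX] eq_pt.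
have : u \in pt v by rewrite eq_pt; apply/imsetP; exists 1; rewrite ?vscale1.
case/imsetP=> c _ uE; exists c; last by rewrite -uE.
by apply: contraNneq u0 => c0; rewrite uE c0 /vscale !mul0r.
Qed.

Lemma eq_linset X Y :
  (forall v, v != (0, 0) -> (pt v \in linset X) = (pt v \in linset Y)) ->
  linset X = linset Y.
Proof.
move=> eqXY; apply/setP => P; apply/idP/idP => PL; have := PL;
  by case/imsetP: PL => u; rewrite !inE => /andP[u0 _] ->; rewrite eqXY.
Qed.

Lemma mem_sscale (c : L) X u : c != 0 -> (u \in sscale c X) = (vscale c^-1 u \in X).
Proof.
move=> c0; apply/imsetP/idP => [[z zX ->] | uX].
  by rewrite vscaleA mulVf // vscale1.
by exists (vscale c^-1 u); rewrite ?vscaleA ?divff ?vscale1.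
Qed.

Lemma linset_sscale (c : L) X : c != 0 -> linset (sscale c X) = linset X.
Proof.
move=> c0; apply: eq_linset => v v0; apply/pt_linsetP/pt_linsetP => // -[d d0].
  by rewrite mem_sscale // vscaleA => h; exists (c^-1 * d); rewrite ?mulf_neq0 ?invr_eq0.
move=> h; exists (c * d); rewrite ?mulf_neq0 //.
by rewrite mem_sscale // vscaleA mulKf.
Qed.

(** With [N = #|L|], nonzero multiples of nonzero vectors of [X] number at most [(N - 1)^2], fewer
    than the [N^2 - 1] nonzero vectors. *)
Lemma exists_pt_notin_linset X : #|X| = #|L| -> (0, 0) \in X ->
  exists2 v, v != (0, 0) & pt v \notin linset X.
Proof.
move=> cardX X0.
have [/forall_inP all_in | /forall_inPn[v v0 vX]] :=
    boolP [forall (v | v != (0, 0)), pt v \in linset X]; last by exists v.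
pose A : {set L * (L * L)} := setX [set~ 0] (X :\ (0, 0)).
have sub : [set~ (0, 0)] \subset [set vscale p.1 p.2 | p in A].
  apply/subsetP => v; rewrite !inE => v0; have /pt_linsetP[//|c c0 cvX] := all_in v v0.
  apply/imsetP; exists (c^-1, vscale c v); last by rewrite /= vscaleA mulVf // vscale1.
  by rewrite !inE /= invr_eq0 c0 vscale_eq0 // v0.
have := leq_trans (subset_leq_card sub) (leq_imset_card _ _).
have := cardsD1 (0, 0) X; rewrite X0 cardX => cX.
rewrite cardsX !cardsC1 card_prod; have := card_finNzRing_gt1 L; rewrite cX.
by move: #|_| => n; nia.
Qed.

Lemma exists_det2_eq1 v : v != (0, 0) -> exists w, det2 w v = 1.
Proof.
case: v => x y; rewrite xpair_eqE negb_and /det2 /=.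
have [-> /= | y0 _] := eqVneq y 0; first by rewrite orbF => x0; exists (0, - x^-1);
  rewrite /= mulr0 sub0r mulrN opprK divff.
by exists (y^-1, 0); rewrite /= mulVf // mulr0 subr0.
Qed.

(* The set of all [x *: w + f x *: v], in the coordinates given by a basis [w, v] with
   [det2 w v = 1]. *)
Definition graph w v (f : L -> L) : {set L * L} := [set u | det2 w u == f (det2 u v)].

Definition comb w v (x y : L) : L * L := (x * w.1 + y * v.1, x * w.2 + y * v.2).

Section Basis.

Variables w v : L * L.
Hypothesis det_wv : det2 w v = 1.

Lemma det2_combl x y : det2 (comb w v x y) v = x.
(* Multiplying one side by [1 = det2 w v] makes the claim a polynomial identity. *)
Proof. by rewrite -[RHS]mulr1 -det_wv /det2 /comb /=; ring. Qed.

Lemma det2_combr x y : det2 w (comb w v x y) = y.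
Proof. by rewrite -[RHS]mulr1 -det_wv /det2 /comb /=; ring. Qed.

Lemma combE u : u = comb w v (det2 u v) (det2 w u).
Proof.
case: u => x y; rewrite /comb; congr (_, _).
  by rewrite -[LHS]mulr1 -det_wv /det2 /=; ring.
by rewrite -[LHS]mulr1 -det_wv /det2 /=; ring.
Qed.

Lemma det2_coord u u' : det2 u u' = det2 u v * det2 w u' - det2 u' v * det2 w u.
Proof. by rewrite -[LHS]mulr1 -det_wv /det2; ring. Qed.

Lemma det2Zl c u : det2 (vscale c u) v = c * det2 u v.
Proof. by rewrite /det2 /=; ring. Qed.

Lemma det2Zr c u : det2 w (vscale c u) = c * det2 w u.
Proof. by rewrite /det2 /=; ring. Qed.

(** For [u] of coordinates [x], [y], the multiple of [u] by [c] lies in the graph when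
    [f (c * x) = c * y], so the slope [y / x] is an eigenvalue; [f 0 = 0] excludes [x = 0]. *)
Lemma linset_graphE f u : f 0 = 0 -> u != (0, 0) ->
  (pt u \in linset (graph w v f)) =
  (det2 u v != 0) && eigenb f (det2 w u / det2 u v).
Proof.
move=> f0 u0; apply/pt_linsetP/andP => // [[c c0] | [x0 /existsP[z /andP[z0 /eqP fz]]]].
  rewrite inE det2Zl det2Zr => /eqP e.
  have x0 : det2 u v != 0.
    apply: contraNneq u0 => x0; move: e; rewrite x0 mulr0 f0 => /eqP.
    rewrite mulf_eq0 (negPf c0) /= => /eqP y0.
    by rewrite (combE u) x0 y0 /comb !mul0r addr0.
  split=> //; apply/existsP; exists (c * det2 u v); rewrite mulf_neq0 // -e.
  by rewrite mulrCA divfK /= ?eqxx.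
exists (z / det2 u v); first by rewrite mulf_neq0 ?invr_eq0.
by rewrite inE det2Zl det2Zr divfK // fz; apply/eqP; ring.
Qed.

Lemma eq_linset_graph f g : f 0 = 0 -> g 0 = 0 ->
  linset (graph w v f) = linset (graph w v g) <-> eigenb f =1 eigenb g.
Proof.
move=> f0 g0; split=> [eq_lin m | eq_eig]; last first.
  by apply: eq_linset => u u0; rewrite !linset_graphE // eq_eig.
have nz : comb w v 1 m != (0, 0).
  apply/eqP => e; have /eqP := det2_combl 1 m.
  by rewrite e /det2 /= !mul0r mulr0 subr0 eq_sym oner_eq0.
have := linset_graphE f0 nz; rewrite eq_lin linset_graphE //.
by rewrite det2_combl det2_combr oner_neq0 divr1.
Qed.

Lemma sscale_graph f g (l : L) : l != 0 -> (forall x, g x = l^-1 * f (l * x)) ->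
  graph w v g = sscale l^-1 (graph w v f).
Proof.
move=> l0 gE; apply/setP => u; rewrite mem_sscale ?invr_eq0 // invrK !inE.
by rewrite det2Zl det2Zr gE -(inj_eq (mulfI l0)) mulVKf.
Qed.

End Basis.

End LinearSets.

(** * Subspaces as graphs of q-polynomials *)

Section SubspacesAsGraphs.

Variables (L : finFieldType) (q : nat) (s : {rmorphism L -> L}).
Hypotheses (cardL : #|L| = (q ^ 4)%N) (sE : forall x, s x = x ^+ q).
Variables w v : L * L.
Hypothesis det_wv : det2 w v = 1.

Local Notation qgraph a := (graph w v (qpoly s a)).

Lemma qpoly0 a : qpoly s a 0 = 0.
Proof. by rewrite /qpoly !rmorph0 !mulr0 !addr0. Qed.

(** [U] contains no nonzero multiple of [v], so the first coordinate is injective on [U], hence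
    bijective onto [L] by cardinality; the second is then an F_q-linear function of it. *)
Lemma subspace_qgraph U : Fsubspace q 1 U -> #|U| = (q ^ 4)%N -> v != (0, 0) ->
  pt v \notin linset U -> exists a, U = qgraph a.
Proof.
case=> U0 UD UZ cardU v0 vU; rewrite expn1 in UZ.
have Fq c : s c = c -> c ^+ q = c by rewrite sE.
have injU : {in U &, injective (fun u => det2 u v)}.
  move=> u u' uU u'U /= e; pose d := (u.1 - u'.1, u.2 - u'.2).
  have dU : d \in U.
    have := UD _ _ uU (UZ (-1) u' (Fq _ (rmorphN1 s)) u'U).
    by rewrite /vscale /= !mulN1r.
  have dv : det2 d v = 0.
    have -> : det2 d v = det2 u v - det2 u' v by rewrite /det2 /d /=; ring.
    by rewrite e subrr.
  have dE : d = vscale (det2 w d) v.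
    by rewrite {1}(combE det_wv d) dv /comb !mul0r !add0r.
  have c0 : det2 w d = 0.
    by apply: contraNeq vU => c0; apply/pt_linsetP => //; exists (det2 w d); rewrite -?dE.
  move: dE; rewrite c0 /vscale /d !mul0r => -[/subr0_eq e1 /subr0_eq e2].
  by case: u u' e1 e2 {uU u'U e d dU dv c0} => x y [x' y'] /= -> ->.
have surjU x : exists2 u, u \in U & det2 u v = x.
  have /setP/(_ x) : [set det2 u v | u in U] = setT.
    by apply/eqP; rewrite eqEcard subsetT cardsT card_in_imset // cardU cardL /= leqnn.
  by rewrite inE => /imsetP[u uU ->]; exists u.
pose f x := det2 w (odflt (0, 0) [pick u in U | det2 u v == x]).
have fE u : u \in U -> f (det2 u v) = det2 w u.
  move=> uU; rewrite /f; case: pickP => [u' /andP[u'U /eqP e] | /(_ u)] /=.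
    by rewrite (injU u' u).
  by rewrite uU eqxx.
have [||a fa] := Fq_linear_qpoly cardL sE (f := f).
- move=> x y; have [[u uU <-] [u' u'U <-]] := (surjU x, surjU y).
  have -> : det2 u v + det2 u' v = det2 (u.1 + u'.1, u.2 + u'.2) v by rewrite /det2 /=; ring.
  by rewrite !fE ?UD // /det2 /=; ring.
- move=> c x /Fq sc; have [u uU <-] := surjU x.
  by rewrite -det2Zl !fE ?UZ // det2Zr.
exists a; apply/setP => u; rewrite inE -fa; apply/idP/eqP => [/fE //|].
have [u' u'U e] := surjU (det2 u v); rewrite -e fE // => e'.
by rewrite (combE det_wv u) -e e' -(combE det_wv u').
Qed.

(** Against the graph point of first coordinate [x], a vector of coordinates [y], [z] pairs to the
    trace of [x * (z - f' y)], with [f'] the adjoint; the trace form is nondegenerate. *)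
Lemma perp_qgraph a : perp q 4 (qgraph a) = qgraph (adj s a).
Proof.
apply/setP => u; rewrite !inE.
have bE u' : u' \in qgraph a ->
    bform q 4 u' u = ftrace s (det2 u' v * (det2 w u - qpoly s (adj s a) (det2 u v))).
  rewrite inE /bform -/(det2 u' u) -(ftraceE sE) => /eqP e.
  rewrite (det2_coord det_wv) e.
  have trB y z : ftrace s (y - z) = ftrace s y - ftrace s z by rewrite /ftrace; ring.
  by rewrite [in RHS]mulrBr !trB -(ftrace_adj cardL sE) [_ * det2 u v]mulrC.
apply/forall_inP/eqP => [h | e u' u'U]; last first.
  by rewrite bE // e subrr mulr0 /ftrace !rmorph0 !addr0.
apply/subr0_eq/(ftrace_nondeg cardL sE) => x.
have xU : comb w v x (qpoly s a x) \in qgraph a.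
  by rewrite inE det2_combl // det2_combr.
by rewrite -[x in x * _](det2_combl det_wv x (qpoly s a x)) -bE //; apply/eqP/h.
Qed.

Lemma linset_perp_qgraph a : linset (perp q 4 (qgraph a)) = linset (qgraph a).
Proof.
rewrite perp_qgraph; apply/eq_linset_graph; rewrite ?qpoly0 //.
exact: (eigen_adj cardL sE).
Qed.

(** Otherwise the map is [a 0 * x + a 2 * s (s x)], and its graph is itself linear over F_{q^2}. *)
Lemma max_linearity_coef a : max_field_linearity q 4 1 (qgraph a) ->
  (a 1 != 0) || (a 3 != 0).
Proof.
case=> _ _ max1; rewrite -negb_and; apply/negP => /andP[/eqP a1 /eqP a3].
have fE x : qpoly s a x = a 0 * x + a 2 * s (s x) by rewrite /qpoly a1 a3; ring.
suff: (2 <= 1)%N by [].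
apply: max1 => //; exists (qgraph a); split=> //; split.
- by rewrite inE fE /det2 /= !mulr0 !mul0r subrr !rmorph0 !mulr0 addr0.
- move=> u u'; rewrite !inE !fE => /eqP e /eqP e'; apply/eqP.
  have D1 : det2 (u.1 + u'.1, u.2 + u'.2) v = det2 u v + det2 u' v by rewrite /det2 /=; ring.
  have D2 : det2 w (u.1 + u'.1, u.2 + u'.2) = det2 w u + det2 w u' by rewrite /det2 /=; ring.
  by rewrite D1 D2 e e'; ring.
- move=> c u; rewrite -(iter_frobE sE 2) /= => sc; rewrite !inE !fE det2Zl det2Zr => /eqP->.
  by rewrite !rmorphM sc /=; apply/eqP; ring.
Qed.

End SubspacesAsGraphs.

(** Since [#|L|] is a power of the characteristic [p], so is [q], and [x ^+ q] is an iterate of the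
    [p]-th power map. *)
Lemma frobenius_morphism (L : finFieldType) (q : nat) : #|L| = (q ^ 4)%N ->
  exists s : {rmorphism L -> L}, forall x, s x = x ^+ q.
Proof.
move=> cardL; have [p p_pr pchL] := finPcharP L.
have : p.-nat #|L|.
  by have := card_pprimeChar pchL; rewrite /= => ->; rewrite pnatX pnat_id.
rewrite cardL pnatX orbF => /p_natP[k ->].
elim: k => [|k [s sE]]; first by exists idfun => x; rewrite expn0 expr1.
by exists (pFrobenius_aut pchL \o s) => x; rewrite /= sE pFrobenius_autE -exprM -expnSr.
Qed.

Theorem mainTheorem19 (L : finFieldType) (q : nat) (U W : {set L * L}) :
  #|L| = (q ^ 4)%N ->
  Fsubspace q 1 U -> #|U| = (q ^ 4)%N ->
  Fsubspace q 1 W -> #|W| = (q ^ 4)%N ->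
  max_field_linearity q 4 1 U ->
  (linset U = linset W <->
   exists lam : L, lam != 0 /\ (W = sscale lam U \/ W = sscale lam (perp q 4 U))).
Proof.
move=> cardL subU cardU subW cardW maxU.
have [s sE] := frobenius_morphism cardL.
have [v v0 vU] : exists2 v, v != (0, 0) & pt v \notin linset U.
  by apply: exists_pt_notin_linset; [rewrite cardU cardL | case: subU].
have [w det_wv] := exists_det2_eq1 v0.
have [a Ua] := subspace_qgraph cardL sE det_wv subU cardU v0 vU.
split=> [eqUW | [l [l0 [] ->]]]; last first.
- by rewrite linset_sscale // Ua linset_perp_qgraph.
- by rewrite linset_sscale.
(* Equal linear sets miss the same point, so [W] is a graph in the same basis. *)
have [|b Wb] := subspace_qgraph cardL sE det_wv subW cardW v0; first by rewrite -eqUW.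
move: maxU eqUW; rewrite Ua Wb => /(max_linearity_coef sE) a13.
rewrite eq_linset_graph ?qpoly0 // => /(same_eigen_invariants cardL sE) inv.
have [l l0 tw] := twist_of_invariants cardL sE inv a13.
(* The graph of [x |-> l^-1 * f (l * x)] is [l^-1] times the graph of [f]. *)
exists l^-1; split; rewrite ?invr_eq0 //.
case: tw => tw; [left | right; rewrite (perp_qgraph cardL sE det_wv)];
  by apply: sscale_graph => // x; apply: qpoly_twist.
Qed.
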